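(* For any connected block graph $G$ and any vertex $x \in V(G)$, \[ p_x(G) = \begin{cases} \mathrm{s}(G) - 1, & \text{if } x \text{ is a simplicial vertex,} \\ \mathrm{s}(G), & \text{otherwise,} \end{cases} \] where $\mathrm{s}(G)$ is the number of simplicial vertices of $G$.
   Context: All graphs are finite, undirected and simple. A graph is a block graph if every maximal $2$-connected component is a clique. A vertex $v$ is simplicial if the subgraph induced by its neighbourhood $N(v)$ is complete. A $u,v$-geodesic is a shortest $u,v$-path. For a vertex $x$ of $G$, a set $S \subseteq V(G)$ is an $x$-position set if for every $y \in S$ no vertex of $S \setminus \{y\}$ lies on any $x,y$-geodesic in $G$. The $x$-position number $p_x(G)$ is the maximum cardinality of an $x$-position set of $G$.
   Formalization: The graph G is assumed to have at least two vertices: for the one-vertex graph, x is simplicial and s(G) = 1, but {x} is an x-position set, so p_x(G) = 1 and not s(G) - 1 = 0. *)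

(* Defs.v *)
From mathcomp Require Import all_boot boolp.

Set Implicit Arguments.
Unset Strict Implicit.
Unset Printing Implicit Defensive.

(* A finite simple graph is a finType T of vertices with an adjacency relation
   e : rel T assumed symmetric and irreflexive wherever it is used. *)

Definition clique (T : finType) (e : rel T) (A : {set T}) : bool :=
  [forall u in A, forall w in A, (u != w) ==> e u w].

Definition simplicial (T : finType) (e : rel T) (v : T) : bool :=
  clique e [set u | e v u].

Definition num_simplicial (T : finType) (e : rel T) : nat :=
  #|[set v | simplicial e v]|.

Definition induced (T : finType) (e : rel T) (A : {set T}) : rel T :=
  [rel u w | [&& u \in A, w \in A & e u w]].

Definition connected_in (T : finType) (e : rel T) (A : {set T}) : bool :=
  [forall u in A, forall w in A, connect (induced e A) u w].

Definition two_connected (T : finType) (e : rel T) (A : {set T}) : bool :=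
  [&& 2 < #|A|, connected_in e A & [forall v in A, connected_in e (A :\ v)]].

(* A maximal 2-connected subgraph is induced, so vertex sets suffice.  The
   blocks with at most two vertices (bridges, isolated vertices) are not
   2-connected in this sense, but they are always cliques. *)
Definition block_graph (T : finType) (e : rel T) : Prop :=
  forall B : {set T}, maxset (two_connected e) B -> clique e B.

(* As in mathcomp's path, the vertex sequence of the path is u :: p and its
   length is size p. *)
Definition is_upath (T : finType) (e : rel T) (u v : T) (p : seq T) : bool :=
  [&& path e u p, uniq (u :: p) & last u p == v].

Definition geodesic (T : finType) (e : rel T) (u v : T) (p : seq T) : Prop :=
  is_upath e u v p /\ forall q : seq T, is_upath e u v q -> size p <= size q.

Definition position_set (T : finType) (e : rel T) (x : T) (S : {set T}) :
    Prop :=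
  forall y : T, y \in S -> forall z : T, z \in S :\ y ->
  forall p : seq T, geodesic e x y p -> z \notin x :: p.

(* The maximum is over a nonempty family: set0 is always a position set. *)
Definition position_number (T : finType) (e : rel T) (x : T) : nat :=
  \max_(S : {set T} | `[< position_set e x S >]) #|S|.

(* Main.v *)
Require Import Defs.
From mathcomp Require Import all_boot boolp.

(** Order the vertices by [y <= z] iff [y] lies on an [x,z]-geodesic; position
    sets are the antichains.  A simplicial vertex is never interior to a
    geodesic, so the simplicial vertices other than [x] form an antichain.
    Conversely, two neighbours of [z] that stay connected after deleting [z]
    lie on a common cycle with [z], hence in a clique.  It follows that
    a maximal vertex is simplicial, and that the predecessor of a vertex on
    a geodesic from [x] is unique, so that the order is a tree order.  Sending
    each member of an antichain to a maximal vertex above it is then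
    injective. *)

Set Implicit Arguments.
Unset Strict Implicit.
Unset Printing Implicit Defensive.

(** * Cycles and cliques in block graphs *)

Section Cycles.

Variables (T : finType) (e : rel T).
Hypothesis e_sym : symmetric e.

Lemma induced_sym (A : {set T}) : symmetric (induced e A).
Proof.
by move=> u w; rewrite /induced /= e_sym; case: (u \in A); case: (w \in A).
Qed.

Lemma connected_in_path (a : T) (q : seq T) :
  path e a q -> connected_in e [set v in a :: q].
Proof.
move=> aq; set A := [set v in _].
have ind_q : path (induced e A) a q.
  have sub : {in [in A] &, subrel e (induced e A)}.
    by move=> u w uA wA euw; rewrite /induced /= euw [u \in A]uA [w \in A]wA.
  by apply: (sub_in_path sub) aq; apply/allP => w wq; rewrite /= inE.
have aA u : u \in A -> connect (induced e A) a u.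
  by rewrite inE => /(path_connect ind_q).
apply/forall_inP => u uA; apply/forall_inP => w wA.
by apply: connect_trans (aA w wA); rewrite (sym_connect_sym (induced_sym A)) aA.
Qed.

(** Rotating the cycle to start at the deleted vertex leaves a path, which is connected. *)
Lemma two_connected_cycle (c : seq T) :
  cycle e c -> uniq c -> 2 < size c -> two_connected e [set v in c].
Proof.
move=> cyc_c uniq_c c_gt2; apply/and3P; split.
- by rewrite cardsE (card_uniqP uniq_c).
- case: c cyc_c {uniq_c c_gt2} => [_|a q];
    first by apply/forall_inP => u; rewrite inE.
  by rewrite /= rcons_path => /andP[/connected_in_path].
- apply/forall_inP => v; rewrite inE => /rot_to[i p rot_c].
  have c_rot : c =i v :: p by move=> w; rewrite -rot_c mem_rot.
  have: cycle e (v :: p) by rewrite -rot_c rot_cycle.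
  have: uniq (v :: p) by rewrite -rot_c rot_uniq.
  case: p rot_c c_rot => [|a q] rot_c c_rot.
    by move: c_gt2; rewrite -(size_rot i) rot_c.
  rewrite [cycle _ _]/= rcons_path => /andP[vq _] /andP[_ /andP[aq _]].
  suff -> : [set w in c] :\ v = [set w in a :: q] by exact: connected_in_path.
  apply/setP => w; rewrite in_setD1 !in_set c_rot [in LHS]in_cons.
  by case: eqP => // ->; rewrite (negPf vq).
Qed.

Hypothesis e_block : block_graph e.

(** A simple path from [u] to [w] avoiding [z] closes up through [z] to a cycle. Its vertices lie in
    one maximal 2-connected set, which is a clique. *)
Lemma block_graph_nbr_adj (z u w : T) :
    e z u -> e z w -> u != w -> connect (induced e [set~ z]) u w -> e u w.
Proof.
move=> ezu ezw neq_uw /connectP[p0 ind_p0 w_last].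
move: neq_uw ezw; rewrite w_last => {w w_last}.
case/shortenP: ind_p0 => p ind_p uniq_p _ neq ezw.
have path_p : path e u p by apply: sub_path ind_p => a b /and3P[].
have zp : z \notin p.
  apply/negP => /splitPr split_p; case: split_p ind_p => p1 p2.
  by rewrite cat_path => /and3P[_ /and3P[_]]; rewrite !inE eqxx.
have neq_zu : z != u.
  case: p ind_p neq {uniq_p path_p zp ezw} => [|b p]; first by rewrite /= eqxx.
  by move=> /andP[/and3P[uz _ _] _] _; rewrite !inE eq_sym in uz.
have cyc : cycle e [:: z, u & p] by rewrite /= rcons_path ezu path_p e_sym.
have uniq_c : uniq [:: z, u & p].
  by rewrite cons_uniq uniq_p inE (negPf neq_zu) zp.
have c_gt2 : 2 < size [:: z, u & p] by case: (p) neq; rewrite //= eqxx.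
have [B maxB subB] := maxset_exists (two_connected_cycle cyc uniq_c c_gt2).
have inB v : v \in u :: p -> v \in B.
  by move=> vp; apply: (subsetP subB); rewrite !inE -in_cons vp orbT.
move/forall_inP/(_ _ (inB u (mem_head _ _))): (e_block maxB).
by move/forall_inP/(_ _ (inB _ (mem_last _ _)))/implyP; exact.
Qed.

End Cycles.

(** * Distance from [x] and the geodesic order *)

Section Distance.

Variables (T : finType) (e : rel T) (x : T).
Hypothesis e_conn : forall u v : T, connect e u v.

Lemma ex_walk_length (y : T) :
  exists n, [exists p : n.-tuple T, path e x p && (last x p == y)].
Proof.
have /connectP[p ep y_last] := e_conn x y.
by exists (size p); apply/existsP; exists (in_tuple p); rewrite ep y_last eqxx.
Qed.

(** Minimising over walks instead of simple paths lets walks be extended without checking [uniq];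
    tuples of fixed length keep the predicate boolean. *)
Definition dist (y : T) : nat := ex_minn (ex_walk_length y).

Lemma dist_path (p : seq T) : path e x p -> dist (last x p) <= size p.
Proof.
move=> ep; rewrite /dist; case: ex_minnP => n _; apply.
by apply/existsP; exists (in_tuple p); rewrite ep eqxx.
Qed.

Lemma ex_dist_path (y : T) :
  exists p, [/\ path e x p, last x p = y & size p = dist y].
Proof.
rewrite /dist; case: ex_minnP => n /existsP[p /andP[ep /eqP lp]] _.
by exists p; rewrite size_tuple.
Qed.

Lemma dist0 : dist x = 0.
Proof. by apply/eqP; rewrite -leqn0; exact: (@dist_path [::]). Qed.

Lemma dist_edge (u v : T) : e u v -> dist v <= (dist u).+1.
Proof.
move=> euv; have [p [ep lp <-]] := ex_dist_path u.
rewrite -(size_rcons p v) -[v in dist v](last_rcons x p).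
by apply: dist_path; rewrite rcons_path ep lp.
Qed.

(** The covering relation of the geodesic order, which is then [connect geostep]. *)
Definition geostep : rel T := [rel u v | e u v && (dist v == (dist u).+1)].

Lemma ex_geostep (z : T) : z != x -> exists u, geostep u z.
Proof.
have [p [+ + +]] := ex_dist_path z.
case/lastP: p => [_ <-|p w]; first by rewrite eqxx.
rewrite rcons_path last_rcons size_rcons => /andP[ep ew] wz szp _.
rewrite wz in ew; exists (last x p).
by rewrite /geostep /= ew eqn_leq dist_edge //= -szp ltnS dist_path.
Qed.

Lemma dist_eq0 (z : T) : dist z = 0 -> z = x.
Proof.
by move=> dz; apply/eqP/negPn/negP => /ex_geostep[u /andP[_]]; rewrite dz.
Qed.

Lemma geostep_connect_root (z : T) : connect geostep x z.
Proof.
have [n] := ubnP (dist z); elim: n z => // n IH z; rewrite ltnS => le_n.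
have [-> //|/ex_geostep[u uz]] := eqVneq z x.
apply: connect_trans (connect1 uz); apply: IH.
by case/andP: uz => _ /eqP dz; rewrite -dz.
Qed.

Lemma dist_geostep_path (a : T) (p : seq T) :
  path geostep a p -> dist (last a p) = size p + dist a.
Proof.
elim: p a => //= b p IH a /andP[/andP[_ /eqP db] /IH ->].
by rewrite db addnS.
Qed.

Lemma dist_connect (y z : T) : connect geostep y z -> dist y <= dist z.
Proof.
by case/connectP=> p /dist_geostep_path + -> => ->; rewrite leq_addl.
Qed.

Lemma dist_last_le (a : T) (p : seq T) :
  path e a p -> dist (last a p) <= size p + dist a.
Proof.
elim: p a => //= b p IH a /andP[/dist_edge ab /IH /leq_trans]; apply.
by rewrite addSnnS leq_add2l.
Qed.

(** An edge raises [dist] by at most one, so a walk whose total gain reaches its length gains one at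
    every edge. *)
Lemma geostep_shortest_path (a : T) (p : seq T) :
  path e a p -> size p + dist a <= dist (last a p) -> path geostep a p.
Proof.
elim: p a => //= b p IH a /andP[ab ep] le.
have le' := dist_last_le ep; have le1 := dist_edge ab.
have db : dist b = (dist a).+1.
  apply/eqP; rewrite eqn_leq le1 -(leq_add2l (size p)) addnS -addSn.
  exact: leq_trans le le'.
by rewrite /geostep /= ab db eqxx IH // db addnS -addSn.
Qed.

Lemma geostep_geodesic (p : seq T) :
  path geostep x p -> geodesic e x (last x p) p.
Proof.
move=> gp; split.
  apply/and3P; split => //; first by apply: sub_path gp => u v /andP[].
  (* No vertex repeats, since [dist] strictly increases along [p]. *)
  have ltn_p : path (relpre dist ltn) x p.
    by apply: sub_path gp => u v /andP[_ /eqP] /= ->.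
  apply: (@sorted_uniq _ (relpre dist ltn)) => //.
    by move=> v u w; apply: ltn_trans.
  by move=> u /=; rewrite ltnn.
move=> q /and3P[xq _ /eqP lq].
have := dist_geostep_path gp; rewrite dist0 addn0 => <-.
by rewrite -lq dist_path.
Qed.

Lemma geodesicP (y : T) (p : seq T) :
  geodesic e x y p <-> path geostep x p /\ last x p = y.
Proof.
split=> [[/and3P[ep _ /eqP lp] min_p]|[gp <-]]; last exact: geostep_geodesic.
split=> //; apply: geostep_shortest_path => //; rewrite dist0 addn0 lp.
have /connectP[q gq yq] := geostep_connect_root y.
have [up _] := geostep_geodesic gq; rewrite -yq in up.
by apply: leq_trans (min_p q up) _; rewrite yq (dist_geostep_path gq) leq_addr.
Qed.

Lemma ex_geodesic_through (y z : T) :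
  connect geostep y z -> exists2 p, geodesic e x z p & y \in x :: p.
Proof.
case/connectP=> q gq ->.
have /connectP[p gp yp] := geostep_connect_root y.
exists (p ++ q); last by rewrite -cat_cons mem_cat {1}yp mem_last.
by apply/geodesicP; rewrite cat_path last_cat gp -yp.
Qed.

(** * Vertex deletion and the lower bound *)

Hypothesis e_sym : symmetric e.

(** Walking back from [u] along a geodesic to [x], every later vertex is strictly closer to [x] than
    [z] is. *)
Lemma connect_root_avoiding (z u : T) :
  u != z -> dist u <= dist z -> connect (induced e [set~ z]) u x.
Proof.
have [n] := ubnP (dist u); elim: n u => // n IH u; rewrite ltnS.
move=> le_n uz le_uz.
have [-> //|/ex_geostep[v /andP[vu /eqP du]]] := eqVneq u x.
rewrite du in le_n le_uz.
have vz : v != z by apply: contraTneq le_uz => ->; rewrite ltnn.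
apply: connect_trans (IH v le_n vz (ltnW le_uz)); apply: connect1.
by rewrite /induced /= !inE uz vz e_sym.
Qed.

Lemma connect_avoiding (z u v : T) :
    u != z -> dist u <= dist z -> v != z -> dist v <= dist z ->
  connect (induced e [set~ z]) u v.
Proof.
move=> uz le_uz vz le_vz.
apply: connect_trans (connect_root_avoiding uz le_uz) _.
by rewrite (sym_connect_sym (induced_sym e_sym _)) connect_root_avoiding.
Qed.

(** A simplicial [z] interior to a geodesic would make its two neighbours there adjacent, although
    their distances from [x] differ by two. *)
Lemma simplicial_position_set :
  position_set e x ([set v | simplicial e v] :\ x).
Proof.
move=> y _ z; rewrite !inE => /and3P[zy zx simp_z] p /geodesicP[gp lp].
rewrite negb_or zx; apply/negP => /splitPr split_p.
case: split_p gp lp => p1 [|b p2].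
  by rewrite last_cat /= => _ yz; rewrite yz eqxx in zy.
rewrite cat_path => /and4P[_ + + _] _; set a := last x p1.
move=> /andP[az /eqP dz] /andP[zb /eqP db].
have ab : a != b.
  by apply/eqP => ab; move: db; rewrite -ab dz => /eqP; rewrite ltn_eqF.
move/forall_inP/(_ a): simp_z; rewrite inE e_sym => /(_ az)/forall_inP/(_ b).
by rewrite inE ab => /(_ zb)/dist_edge; rewrite db dz ltnn.
Qed.

(** * The tree order of a block graph *)

Hypotheses (e_irr : irreflexive e) (e_block : block_graph e).

(* If [u != v], then [z] and a predecessor [t] of [u] stay connected, through
   [v], after deleting [u]; so they are adjacent, at distances two apart. *)
Lemma geostep_inj (u v z : T) : geostep u z -> geostep v z -> u = v.
Proof.
move=> /andP[uz /eqP dzu] /andP[vz /eqP dzv].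
apply/eqP/negPn/negP => neq_uv.
have duv : dist v = dist u by apply: succn_inj; rewrite -dzu.
have ux : u != x.
  apply: contraNneq neq_uv => ux; rewrite ux eq_sym.
  by apply/eqP/dist_eq0; rewrite duv ux dist0.
have [t /andP[tu /eqP dut]] := ex_geostep ux.
have zu : z != u by apply: contraTneq uz => ->; rewrite e_irr.
have tu' : t != u by apply: contraTneq tu => ->; rewrite e_irr.
have vu : v != u by rewrite eq_sym.
have zt : t != z.
  by apply/eqP => tz; move: dzu; rewrite dut tz => /eqP; rewrite ltn_eqF.
have con : connect (induced e [set~ u]) t z.
  apply: (@connect_trans _ _ v).
    by apply: connect_avoiding; rewrite ?duv ?dut.
  by apply: connect1; rewrite /induced /= !inE vu zu.
have := block_graph_nbr_adj e_sym e_block _ _ zt con.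
by rewrite e_sym => /(_ tu uz)/dist_edge; rewrite dzu dut ltnn.
Qed.

(** Predecessors being unique, two geodesic walks ending at [z] agree backwards from [z] until the
    shorter one is exhausted. *)
Lemma geostep_comparable (y y' z : T) :
    connect geostep y z -> connect geostep y' z ->
  connect geostep y y' \/ connect geostep y' y.
Proof.
case/connectP=> p gp zp /connectP[q gq zq].
elim/last_ind: p z q gp zp gq zq => [|p w IH] z q.
  by move=> _ /= <- gq ->; right; apply/connectP; exists q.
case/lastP: q => [gp zp _ /= <-|q w'].
  by left; apply/connectP; exists (rcons p w).
rewrite !rcons_path !last_rcons => /andP[gp gw] -> /andP[gq gw'] ww'.
rewrite -ww' in gw'; exact: IH gp erefl gq (geostep_inj gw gw').
Qed.

(** All neighbours of [z] reach [x] without passing through [z], so they are pairwise adjacent. *)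
Lemma maximal_simplicial (z : T) :
  z != x -> (forall w, e z w -> dist w <= dist z) -> simplicial e z.
Proof.
move=> zx max_z; apply/forall_inP => u; rewrite inE => zu.
apply/forall_inP => w; rewrite inE => zw; apply/implyP => uw.
have nbr_neq v : e z v -> v != z by apply: contraTneq => ->; rewrite e_irr.
apply: (block_graph_nbr_adj e_sym e_block zu zw uw).
by apply: connect_avoiding; rewrite ?nbr_neq ?max_z.
Qed.

(** * The upper bound *)

Hypothesis T_gt1 : 1 < #|T|.

Lemma ex_simplicial_above (y : T) :
  exists2 z, z \in [set v | simplicial e v] :\ x & connect geostep y z.
Proof.
have [z yz max_z] := arg_maxnP (fun z => dist z) (connect0 geostep y).
(* Take [z] farthest from [x] among the vertices above [y]. Were [z] equal to [x], then [y] would be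
   [x], which lies below every vertex, so all distances would vanish and the graph would have one
   vertex. *)
exists z => //; rewrite !inE; have zx : z != x.
  apply/eqP => zx; have yx : y = x.
    by apply: dist_eq0; apply/eqP; rewrite -leqn0 -dist0 -zx dist_connect.
  have /card_gt1P[a [b [_ _ /negP[]]]] := T_gt1.
  have all_x w : w = x.
    apply: dist_eq0; apply/eqP; rewrite -leqn0 -dist0 -[in leqRHS]zx.
    by apply: max_z; rewrite yx geostep_connect_root.
  by rewrite (all_x a) (all_x b).
rewrite zx; apply: maximal_simplicial => // w zw.
(* A neighbour farther than [z] would also lie above [y]. *)
rewrite leqNgt; apply/negP => lt_zw.
suff /max_z: connect geostep y w by rewrite /= leqNgt lt_zw.
apply: connect_trans yz (connect1 _).
by rewrite /geostep /= zw eqn_leq lt_zw dist_edge.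
Qed.

Lemma card_position_set (S : {set T}) :
  position_set e x S -> #|S| <= #|[set v | simplicial e v] :\ x|.
Proof.
move=> posS.
pose f y := s2val (sig2W (ex_simplicial_above y)).
have f_simp y : f y \in [set v | simplicial e v] :\ x.
  by rewrite /f; case: sig2W.
have f_above y : connect geostep y (f y) by rewrite /f; case: sig2W.
have anti y z : y \in S -> z \in S -> connect geostep z y -> z = y.
  move=> yS zS /ex_geodesic_through[p gp zp].
  by apply/eqP; apply: contraLR zp => zy; apply: posS gp; rewrite // !inE zy.
(* Members with the same image lie below a common vertex, so they are comparable, and [anti] makes
   them equal. *)
have f_inj : {in S &, injective f}.
  move=> y z yS zS fyz; have := f_above y; rewrite fyz => yf.
  by have [/anti ->|/anti <-] := geostep_comparable yf (f_above z).
rewrite -(card_in_imset f_inj); apply: subset_leq_card.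
by apply/subsetP => _ /imsetP[y _ ->].
Qed.

End Distance.

Theorem theorem3p5 (T : finType) (e : rel T) (e_sym : symmetric e)
    (e_irr : irreflexive e) (T_gt1 : 1 < #|T|)
    (e_conn : forall u v : T, connect e u v) (e_block : block_graph e) (x : T) :
  position_number e x =
    if simplicial e x then num_simplicial e - 1 else num_simplicial e.
Proof.
(* Both cases of the formula count the simplicial vertices other than [x]. *)
transitivity #|[set v | simplicial e v] :\ x|.
  apply/eqP; rewrite eqn_leq; apply/andP; split.
    by apply/bigmax_leqP => S /asboolP; exact: card_position_set.
  apply: (@leq_bigmax_cond _ _ (fun S : {set T} => #|S|)).
  by apply/asboolP; exact: simplicial_position_set.
rewrite /num_simplicial (cardsD1 x [set v | _]) inE.
by case: simplicial; rewrite ?addKn.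
Qed.
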